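(* Let $k\geq 1$ and let $G$ and $H$ be finite simple graphs with $\delta(G)+\delta(H)\geq k$. Then $\gamma_{\times k,t}(G\Box H)\geq k\,\rho(G)\,\rho(H)$.
   Context: All graphs are finite, undirected and simple; $\delta(G)$ denotes the minimum degree. For $k\geq 1$, a set $S\subseteq V(G)$ is a $k$-tuple total dominating set if every vertex $v$ has at least $k$ neighbors in $S$ (i.e. $|N(v)\cap S|\geq k$, $N(v)$ the open neighborhood); such a set exists iff $\delta(G)\geq k$, and then $\gamma_{\times k,t}(G)$ is the minimum cardinality of such a set. A packing is a set of vertices whose closed neighborhoods $N[v]=N(v)\cup\{v\}$ are pairwise disjoint; $\rho(G)$ is the maximum cardinality of a packing. The Cartesian product $G\Box H$ has vertex set $V(G)\times V(H)$, with $(u_1,v_1)$ adjacent to $(u_2,v_2)$ iff either $u_1=u_2$ and $v_1v_2\in E(H)$, or $v_1=v_2$ and $u_1u_2\in E(G)$; note $\delta(G\Box H)=\delta(G)+\delta(H)$. *)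

(* Defs.v *)
From mathcomp Require Import all_boot.

Set Implicit Arguments.
Unset Strict Implicit.
Unset Printing Implicit Defensive.

Record sgraph := SGraph {
  vertex :> finType;
  adj : rel vertex;
  adj_sym : symmetric adj;
  adj_irrefl : irreflexive adj
}.

Definition open_nbh (G : sgraph) (v : G) : {set G} := [set u | adj v u].

Definition closed_nbh (G : sgraph) (v : G) : {set G} := v |: open_nbh v.

(* Every degree is at most #|G|, so the default value #|G| never affects the
   minimum when G has a vertex; the graph without vertices gets 0. *)
Definition min_degree (G : sgraph) : nat :=
  \big[minn/#|G|]_(v : G) #|open_nbh v|.

Definition ktuple_total_dominating (k : nat) (G : sgraph) (S : {set G}) : bool :=
  [forall v : G, k <= #|open_nbh v :&: S|].

(* Meaningful only when a k-tuple total dominating set exists: see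
   ktuple_total_dominating_exists and ktuple_total_domination_numberP.
   Otherwise the value is #|G|. *)
Definition ktuple_total_domination_number (k : nat) (G : sgraph) : nat :=
  #|[arg min_(S < [set: G] | ktuple_total_dominating k S) #|S|]|.

Definition packing (G : sgraph) (P : {set G}) : bool :=
  [forall u in P, forall v in P,
     (u != v) ==> [disjoint closed_nbh u & closed_nbh v]].

Definition packing_number (G : sgraph) : nat :=
  \max_(P : {set G} | packing P) #|P|.

Section CartesianProduct.
Variables G H : sgraph.

Definition cart_adj : rel (G * H) := fun p q =>
  ((p.1 == q.1) && adj p.2 q.2) || ((p.2 == q.2) && adj p.1 q.1).

Lemma cart_adj_sym : symmetric cart_adj.
Proof.
move=> p q; rewrite /cart_adj [p.1 == _]eq_sym [p.2 == _]eq_sym.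
by rewrite (adj_sym p.2) (adj_sym p.1).
Qed.

Lemma cart_adj_irrefl : irreflexive cart_adj.
Proof. by move=> p; rewrite /cart_adj !adj_irrefl !andbF. Qed.

Definition cart_prod : sgraph := SGraph cart_adj_sym cart_adj_irrefl.

End CartesianProduct.

Lemma min_degree_leq (G : sgraph) (v : G) : min_degree G <= #|open_nbh v|.
Proof.
rewrite /min_degree; have := mem_index_enum v.
elim: (index_enum G) => // u r IHr; rewrite inE big_cons => /orP[/eqP<-|/IHr].
  exact: geq_minl.
by apply: leq_trans; apply: geq_minr.
Qed.

Lemma min_degree_attained (G : sgraph) (v0 : G) :
  exists v : G, min_degree G = #|open_nbh v|.
Proof.
have [v _ vP] := @arg_minnP G v0 predT (fun v => #|open_nbh v|) isT.
exists v; apply/eqP; rewrite eqn_leq min_degree_leq /=.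
rewrite /min_degree; apply: (big_ind (fun m => #|open_nbh v| <= m)).
- exact: max_card.
- by move=> m n vm vn; rewrite leq_min vm.
- by move=> u _; apply: vP.
Qed.

Lemma ktuple_total_dominating_setT (k : nat) (G : sgraph) :
  k <= min_degree G -> ktuple_total_dominating k [set: G].
Proof.
move=> kG; apply/forallP => v; rewrite setIT.
exact: leq_trans kG (min_degree_leq v).
Qed.

Lemma ktuple_total_dominating_exists (k : nat) (G : sgraph) (v0 : G) :
  (exists S : {set G}, ktuple_total_dominating k S) <-> k <= min_degree G.
Proof.
split=> [[S /forallP domS]|kG]; last first.
  by exists [set: G]; apply: ktuple_total_dominating_setT.
have [v ->] := min_degree_attained v0.
exact: leq_trans (domS v) (subset_leq_card (subsetIl _ _)).
Qed.

Lemma ktuple_total_domination_numberP (k : nat) (G : sgraph) (S0 : {set G}) :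
  ktuple_total_dominating k S0 ->
  (exists2 S : {set G}, ktuple_total_dominating k S
     & #|S| = ktuple_total_domination_number k G)
  /\ (forall S : {set G}, ktuple_total_dominating k S ->
        ktuple_total_domination_number k G <= #|S|).
Proof.
move=> /forallP domS0; rewrite /ktuple_total_domination_number.
have domT : ktuple_total_dominating k [set: G].
  apply/forallP => v; apply: leq_trans (domS0 v) _.
  by rewrite subset_leq_card // setIS // subsetT.
by case: arg_minnP => // S domS minS; split; [exists S | exact: minS].
Qed.

Lemma packing_number_attained (G : sgraph) :
  exists2 P : {set G}, packing P & #|P| = packing_number G.
Proof.
have pack0 : packing (set0 : {set G}).
  by apply/forallP => u; rewrite inE.
have [//|P packP eqP] := @eq_bigmax_cond _ (@packing G) (fun P => #|P|).
  by apply/card_gt0P; exists set0.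
by exists P.
Qed.

Lemma min_degree_cart_prod (G H : sgraph) (u0 : G) (v0 : H) :
  min_degree (cart_prod G H) = min_degree G + min_degree H.
Proof.
have deg (p : cart_prod G H) :
    #|open_nbh p| = #|open_nbh p.1| + #|open_nbh p.2|.
  case: p => u v /=.
  have -> : open_nbh ((u, v) : cart_prod G H) =
      setX (open_nbh u) [set v] :|: setX [set u] (open_nbh v).
    apply/setP => -[x y]; rewrite !inE /= /cart_adj /= [u == x]eq_sym.
    by rewrite [v == y]eq_sym orbC [(y == v) && _]andbC.
  rewrite cardsU !cardsX !cards1 muln1 mul1n.
  suff -> : setX (open_nbh u) [set v] :&: setX [set u] (open_nbh v) = set0.
    by rewrite cards0 subn0.
  apply/setP => -[x y]; rewrite !inE /=.
  by case: (x =P u) => [->|_]; rewrite ?adj_irrefl ?andbF.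
apply/eqP; rewrite eqn_leq; apply/andP; split.
  have [u ->] := min_degree_attained u0; have [v ->] := min_degree_attained v0.
  by rewrite -(deg (u, v)) min_degree_leq.
have [p ->] := @min_degree_attained (cart_prod G H) (u0, v0).
by rewrite deg leq_add // min_degree_leq.
Qed.

(* Main.v *)
(* If P and Q are packings of G and H, the open neighborhoods in the product of
   the points of P x Q are pairwise disjoint, because the one of (u, v) lies in
   N[u] x N[v].  Each of them contains k elements of a dominating set. *)
Require Import Defs.
From mathcomp Require Import all_boot.

Lemma packing_inj {G : sgraph} {P : {set G}} {u v x : G} :
  packing P -> u \in P -> v \in P ->
  x \in closed_nbh u -> x \in closed_nbh v -> u = v.
Proof.
move=> /forall_inP packP uP vP xu xv; apply/eqP/contraT => neq_uv.
have /forall_inP/(_ v vP)/implyP/(_ neq_uv) := packP u uP.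
by move=> /disjointFr/(_ xu); rewrite xv.
Qed.

(** An edge of the product fixes one coordinate, hence the closed neighborhoods. *)
Lemma open_nbh_cart_prod (G H : sgraph) (p x : cart_prod G H) :
  x \in open_nbh p -> (x.1 \in closed_nbh p.1) && (x.2 \in closed_nbh p.2).
Proof.
rewrite !inE /= /cart_adj.
by case/orP => /andP[/eqP-> ->]; rewrite eqxx ?orbT.
Qed.

(** Double counting of the pairs (u, x) with u in [A], x in [S] and x adjacent to u: each u lies in
    at least [k] pairs, each x in at most one. *)
Lemma ktuple_total_dominating_card (k : nat) (G : sgraph) (A S : {set G}) :
  {in A &, forall u v x, x \in open_nbh u -> x \in open_nbh v -> u = v} ->
  ktuple_total_dominating k S -> k * #|A| <= #|S|.
Proof.
move=> injA /forallP domS; rewrite mulnC -sum_nat_const.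
apply: (@leq_trans (\sum_(u in A) \sum_(x in S) (x \in open_nbh u))).
  apply: leq_sum => u _; apply: leq_trans (domS u) _.
  rewrite setIC -sum1_card (eq_bigl _ _ (fun x => in_setI x S _)) big_mkcondr.
  by apply: leq_sum => x _; case: ifP.
rewrite exchange_big -sum1_card; apply: leq_sum => x _.
have -> : \sum_(u in A) (x \in open_nbh u) = #|[set u in A | x \in open_nbh u]|.
  by rewrite -sum1dep_card big_mkcondr; apply: eq_bigr => u _; case: ifP.
apply/card_le1_eqP => u v; rewrite !inE => /andP[uA xu] /andP[vA xv].
by apply: (injA v u vA uA x); rewrite inE.
Qed.

Theorem theorem2 (k : nat) (G H : sgraph)
    (k_ge1 : 1 <= k)
    (k_le_deg : k <= min_degree G + min_degree H) :
  k * packing_number G * packing_number H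
    <= ktuple_total_domination_number k (cart_prod G H).
Proof.
have [P packP <-] := packing_number_attained G.
have [Q packQ <-] := packing_number_attained H.
(* An empty packing makes the left side 0. Otherwise [u0] and [v0] supply the vertices that
   [min_degree_cart_prod] asks for. *)
have [->|[u0 _]] := set_0Vmem P; first by rewrite cards0 muln0.
have [->|[v0 _]] := set_0Vmem Q; first by rewrite cards0 muln0.
(* Feasibility: the domination number is then the size of an actual dominating set, not a default
   value. *)
have domT : ktuple_total_dominating k [set: cart_prod G H].
  by apply: ktuple_total_dominating_setT; rewrite (min_degree_cart_prod u0 v0).
have [[S domS <-] _] := ktuple_total_domination_numberP domT.
rewrite -mulnA -cardsX; apply: ktuple_total_dominating_card domS.
move=> [u v] [u' v'] /setXP[uP vQ] /setXP[uP' vQ'] x.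
move=> /open_nbh_cart_prod/andP[/= xu xv] /open_nbh_cart_prod/andP[/= xu' xv'].
by rewrite (packing_inj packP uP uP' xu xu') (packing_inj packQ vQ vQ' xv xv').
Qed.
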